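(* Let $1\le k\le n$, let $A\colon\mathbb{R}\to\mathfrak{gl}(n)=\mathbb{C}^{n\times n}$ depend on $x$ only, and consider the linear vector field $V(x,Y)=A(x)\,Y$ on the Stiefel manifold $\mathbb{V}(n,k)$. Fix a multi-index $\mathfrak{i}\subset\{1,\ldots,n\}$ of cardinality $k$, and let $a(x),b(x),c(x),d(x)$ denote respectively the $\mathfrak{i}\times\mathfrak{i}$, $\mathfrak{i}\times\mathfrak{i}^\circ$, $\mathfrak{i}^\circ\times\mathfrak{i}$ and $\mathfrak{i}^\circ\times\mathfrak{i}^\circ$ submatrices of $A(x)$. Let $Y=Y(x)\in\mathbb{V}(n,k)$ be a solution of $Y'=A(x)Y$ on an interval on which $Y(x)=y_{\mathfrak{i}^\circ}(x)\,u(x)$ with $u(x)\in\mathrm{GL}(k)$ and $y_{\mathfrak{i}^\circ}(x)\in\mathbb{C}^{n\times k}$ having $I_k$ as its submatrix of rows indexed by $\mathfrak{i}$, and let $\hat y(x)=\varphi_{\mathfrak{i}}(y_{\mathfrak{i}^\circ}(x))\in\mathbb{C}^{(n-k)\times k}$ be the submatrix of rows of $y_{\mathfrak{i}^\circ}(x)$ indexed by $\mathfrak{i}^\circ$. Then: (1) the flow on the base space $\mathrm{Gr}(n,k)$ decouples from the flow through the fibres $\mathrm{GL}(k)$, and the latter is slaved to the former: $\hat y$ satisfies a differential equation not involving $u$, namely the one in (2), while $u$ satisfies $u'=(a(x)+b(x)\hat y)\,u$, whose coefficient depends only on $x$ and $\hat y$; (2) in the chart variable $\hat y$ of the fixed coordinate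 patch $\mathbb{U}_{\mathfrak{i}}$, the flow is governed by the Riccati differential system \[ \hat y'=c(x)+d(x)\,\hat y-\hat y\,a(x)-\hat y\,b(x)\,\hat y . \]
   Context: $\mathbb{V}(n,k)$ is the Stiefel manifold of $k$-frames in $\mathbb{C}^n$: the open set of matrices in $\mathbb{C}^{n\times k}$ of rank $k$. It is a principal fibre bundle over the Grassmannian $\mathrm{Gr}(n,k)$ of $k$-dimensional subspaces of $\mathbb{C}^n$ (a frame is sent to its span) with fibres homeomorphic to $\mathrm{GL}(k)$, the group of invertible complex $k\times k$ matrices. For a multi-index $\mathfrak{i}\subset\{1,\ldots,n\}$ of cardinality $k$, $\mathfrak{i}^\circ=\{1,\ldots,n\}\setminus\mathfrak{i}$. The coordinate patch $\mathbb{U}_{\mathfrak{i}}$ of $\mathrm{Gr}(n,k)$ is the set of $k$-planes for which the $\mathfrak{i}$-rows submatrix of one (hence any) $n\times k$ matrix whose columns form a basis is invertible. Each element of $\mathbb{U}_{\mathfrak{i}}$ has a unique representing matrix $y_{\mathfrak{i}^\circ}$ whose $\mathfrak{i}$-rows submatrix is $I_k$, and the coordinate chart $\varphi_{\mathfrak{i}}\colon\mathbb{U}_{\mathfrak{i}}\to\mathbb{C}^{(n-k)k}$ sends $y_{\mathfrak{i}^\circ}$ to its submatrix $\hat y$ of rows indexed by $\mathfrak{i}^\circ$. For index sets $\mathfrak{p},\mathfrak{q}$, the $\mathfrak{p}\times\mathfrak{q}$ submatrix of a matrix consists of the entries with row index in $\mathfrak{p}$ and column index in $\mathfrak{q}$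 (indices in increasing order). The prime denotes $d/dx$. *)

(* Defs.v *)
From HB Require Import structures.
From mathcomp Require Import all_boot all_order all_algebra.
From mathcomp Require Import complex.
From mathcomp Require Import all_classical all_reals all_analysis.

Set Implicit Arguments.
Unset Strict Implicit.
Unset Printing Implicit Defensive.
Import Order.TTheory GRing.Theory Num.Theory.
Import numFieldNormedType.Exports.

Local Open Scope classical_set_scope.
Local Open Scope ring_scope.
Local Open Scope complex_scope.

Record multi_index (n k : nat) := MultiIndex {
  mi_set :> {set 'I_n};
  mi_card : #|mi_set| = k }.

Lemma mi_compl_card (n k : nat) (p : multi_index n k) :
  #|~: mi_set p| = (n - k)%N.
Proof. by rewrite cardsCs finset.setCK card_ord mi_card. Qed.

Definition mi_compl (n k : nat) (p : multi_index n k) : multi_index n (n - k) :=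
  MultiIndex (mi_compl_card p).

(* The increasing enumeration of a multi-index (see mi_nth_mono). *)
Definition mi_nth (n k : nat) (p : multi_index n k) (j : 'I_k) : 'I_n :=
  enum_val (cast_ord (esym (mi_card p)) j).

Lemma mi_nth_mono (n k : nat) (p : multi_index n k) (j1 j2 : 'I_k) :
  (j1 < j2)%N -> (mi_nth p j1 < mi_nth p j2)%N.
Proof.
move=> lt12; have s_enum : sorted ltn [seq val i | i <- enum (mi_set p)].
  apply: (subseq_sorted ltn_trans) (iota_ltn_sorted 0 n).
  rewrite -val_enum_ord; apply: map_subseq.
  by rewrite [enum (mi_set p)]/enum_mem -enumT filter_subseq.
have sz j : (nat_of_ord (cast_ord (esym (mi_card p)) j)
             < size (enum (mi_set p)))%N by rewrite -cardE ltn_ord.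
rewrite /mi_nth !(enum_val_nth (mi_nth p j1)).
rewrite -!(nth_map (mi_nth p j1) 0%N val) //.
by apply: (sorted_ltn_nth ltn_trans) => //; rewrite inE size_map.
Qed.

Definition rows_at (T : Type) (n k m : nat) (p : multi_index n k)
  (M : 'M[T]_(n, m)) : 'M[T]_(k, m) := rowsub (mi_nth p) M.

Definition submx_at (T : Type) (n k l : nat) (p : multi_index n k)
  (q : multi_index n l) (M : 'M[T]_n) : 'M[T]_(k, l) :=
  mxsub (mi_nth p) (mi_nth q) M.

Definition stiefel (R : realType) (n k : nat) : set 'M[R[i]]_(n, k) :=
  [set Y | \rank Y = k].

Definition grassmannian (R : realType) (n k : nat) :
    set {vspace 'cV[R[i]]_n} :=
  [set W | \dim W = k].

(* The bundle projection, sending a frame to its span. *)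
Definition column_span (R : realType) (n k : nat) (Y : 'M[R[i]]_(n, k)) :
    {vspace 'cV[R[i]]_n} :=
  <<[seq col j Y | j <- enum 'I_k]>>%VS.

Definition coordinate_patch (R : realType) (n k : nat) (p : multi_index n k) :
    set {vspace 'cV[R[i]]_n} :=
  [set W | grassmannian k W /\
    exists Y : 'M[R[i]]_(n, k),
      [/\ stiefel Y, column_span Y = W & rows_at p Y \in unitmx]].

(* The set of matrices is a singleton when W is in coordinate_patch p; outside
   the patch it is empty and chart takes a junk value. *)
Definition chart (R : realType) (n k : nat) (p : multi_index n k)
    (W : {vspace 'cV[R[i]]_n}) : 'M[R[i]]_(n - k, k) :=
  rows_at (mi_compl p)
    (xget 0 [set y : 'M[R[i]]_(n, k) |
             column_span y = W /\ rows_at p y = 1%:M]).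

(* M has derivative D at x relative to J: the usual derivative at interior
   points of J, a one-sided one at endpoints belonging to J.  The limit is in
   the product topology of complex matrices; R[i]^o is R[i] with the topology
   given by the modulus. *)
Definition has_deriv (R : realType) (m l : nat) (J : interval R)
    (M : R -> 'M[R[i]]_(m, l)) (x : R) (D : 'M[R[i]]_(m, l)) : Prop :=
  ((fun t : R => ((t - x)^-1)%:C *: (M t - M x)) : R -> 'M[R[i]^o]_(m, l))
    @ within [set` J] x^' --> (D : 'M[R[i]^o]_(m, l)).

Definition solves (R : realType) (m l : nat) (J : interval R)
    (V : R -> 'M[R[i]]_(m, l) -> 'M[R[i]]_(m, l))
    (M : R -> 'M[R[i]]_(m, l)) : Prop :=
  forall x, x \in J -> has_deriv J M x (V x (M x)).

Definition linear_field (R : realType) (n k : nat) (A : R -> 'M[R[i]]_n)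
    (x : R) (Y : 'M[R[i]]_(n, k)) : 'M[R[i]]_(n, k) := A x *m Y.

(* The base curve z solves its own equation z' = F(x, z), in which u does not
   occur; the fibre curve u is slaved to it by u' = G(x, z) u. *)
Definition decoupled (R : realType) (m k : nat) (J : interval R)
    (F : R -> 'M[R[i]]_(m, k) -> 'M[R[i]]_(m, k))
    (G : R -> 'M[R[i]]_(m, k) -> 'M[R[i]]_k)
    (z : R -> 'M[R[i]]_(m, k)) (u : R -> 'M[R[i]]_k) : Prop :=
  solves J F z /\ solves J (fun x v => G x (z x) *m v) u.

(* Main.v *)
(* The normalisation of y on the rows p makes u the p-rows of Y and yhat u the
   q-rows of Y, so splitting A by blocks turns Y' = A Y into
   u' = (a + b yhat) u and (yhat u)' = (c + d yhat) u.  The product rule then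
   gives yhat' = ((yhat u)' - yhat u') u^-1, in which u cancels. *)
Require Import Defs.
From HB Require Import structures.
From mathcomp Require Import all_boot all_order all_algebra.
From mathcomp Require Import complex.
From mathcomp Require Import all_classical all_reals all_analysis.

Set Implicit Arguments.
Unset Strict Implicit.
Unset Printing Implicit Defensive.
Import Order.TTheory GRing.Theory Num.Theory.
Import numFieldNormedType.Exports.

Local Open Scope classical_set_scope.
Local Open Scope ring_scope.
Local Open Scope complex_scope.

(** * Limits of matrix-valued functions, entry by entry *)

Lemma cvg_mxP (T : Type) (F : set_system T) (FF : Filter F)
    (U : topologicalType) (m l : nat) (f : T -> 'M[U]_(m, l))
    (M : 'M[U]_(m, l)) :
  f @ F --> M <-> forall i j, f t i j @[t --> F] --> M i j.
Proof.
split=> [fM i j P MP|fM P [Q MQ sQP]].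
  apply: (fM [set N | P (N i j)]).
  (* Only the entry [(i, j)] is constrained; all others stay free. *)
  exists (fun i' j' => if (i' == i) && (j' == j) then P else setT).
    by move=> i' j'; case: ifP => [/andP[/eqP-> /eqP->] //|_]; exact: filterT.
  by move=> N /(_ i j) /=; rewrite !eqxx.
(* There are finitely many entries, so their conditions hold simultaneously along [F]. *)
have QF : \forall t \near F, forall ij, Q ij.1 ij.2 (f t ij.1 ij.2).
  by apply: filter_forall => ij; exact: fM (MQ _ _).
by apply: filterS QF => t Qt; apply: sQP => i j; exact: (Qt (i, j)).
Qed.

Section MatrixLimits.
Variables (T : Type) (F : set_system T) (FF : Filter F) (K : numFieldType).

Lemma cvg_addmx (m l : nat) (f g : T -> 'M[K]_(m, l)) (M N : 'M[K]_(m, l)) :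
  (f : T -> 'M[K^o]_(m, l)) @ F --> (M : 'M[K^o]_(m, l)) ->
  (g : T -> 'M[K^o]_(m, l)) @ F --> (N : 'M[K^o]_(m, l)) ->
  ((fun t => f t + g t) : T -> 'M[K^o]_(m, l)) @ F --> (M + N : 'M[K^o]_(m, l)).
Proof.
move=> /cvg_mxP fM /cvg_mxP gN; apply/cvg_mxP => i j.
rewrite mxE; under eq_fun do rewrite mxE.
exact: (cvgD (fM i j) (gN i j)).
Qed.

Lemma cvg_mulmx (m l r : nat) (f : T -> 'M[K]_(m, l)) (g : T -> 'M[K]_(l, r))
    (M : 'M[K]_(m, l)) (N : 'M[K]_(l, r)) :
  (f : T -> 'M[K^o]_(m, l)) @ F --> (M : 'M[K^o]_(m, l)) ->
  (g : T -> 'M[K^o]_(l, r)) @ F --> (N : 'M[K^o]_(l, r)) ->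
  ((fun t => f t *m g t) : T -> 'M[K^o]_(m, r)) @ F
    --> (M *m N : 'M[K^o]_(m, r)).
Proof.
move=> /cvg_mxP fM /cvg_mxP gN; apply/cvg_mxP => i j.
rewrite mxE; under eq_fun do rewrite mxE.
apply: (@cvg_big K^o _ _ _ _ add_continuous) => h _.
exact: (cvgM (fM i h) (gN h j)).
Qed.

(** By the Leibniz formula the determinant is a finite sum of signed products of entries. *)
Lemma cvg_det (m : nat) (f : T -> 'M[K]_m) (M : 'M[K]_m) :
  (f : T -> 'M[K^o]_m) @ F --> (M : 'M[K^o]_m) ->
  ((fun t => \det (f t)) : T -> K^o) @ F --> (\det M : K^o).
Proof.
move=> /cvg_mxP fM.
apply: (@cvg_big K^o _ _ _ _ add_continuous) => s _.
apply: (@cvgM K); first exact: cvg_cst.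
by apply: (@cvg_big K^o _ _ _ _ mul_continuous) => i _; exact: fM.
Qed.

(** Cramer's rule: the inverse is the adjugate over the determinant, and cofactors are signed
    determinants. Invertibility near the limit makes the formula apply, since [invmx] returns a
    singular matrix unchanged. *)
Lemma cvg_invmx (m : nat) (f : T -> 'M[K]_m) (M : 'M[K]_m) :
  M \in unitmx -> (\forall t \near F, f t \in unitmx) ->
  (f : T -> 'M[K^o]_m) @ F --> (M : 'M[K^o]_m) ->
  ((fun t => invmx (f t)) : T -> 'M[K^o]_m) @ F --> (invmx M : 'M[K^o]_m).
Proof.
move=> Mu fu fM.
have Ff : {near F, (fun t => (\det (f t))^-1 *: \adj (f t))
    =1 (fun t => invmx (f t))}.
  by apply: filterS fu => t ftu; rewrite /invmx ftu.
apply: (cvg_trans (near_eq_cvg Ff)); rewrite /invmx Mu.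
apply/cvg_mxP => i j; rewrite !mxE; under eq_fun do rewrite !mxE.
apply: (@cvgM K).
  apply: (@cvgV K); last exact: cvg_det fM.
  by rewrite -unitfE -unitmxE.
apply: (@cvgM K); first exact: cvg_cst.
apply: cvg_det; apply/cvg_mxP => i' j'; rewrite !mxE.
under eq_fun do rewrite !mxE.
exact: (cvg_mxP _ _ _).1 fM _ _.
Qed.

End MatrixLimits.

(** * Complex matrix derivatives along a real interval *)

Section ComplexDerivative.
Variables (R : realType) (J : interval R) (x : R).

Lemma cvg_increment0 :
  ((t - x)%:C : R[i]^o) @[t --> within [set` J] x^'] --> (0 : R[i]^o).
Proof.
apply: (@cvg_trans _ ((t - x)%:C @[t --> x] : set_system R[i]^o)).
  by move=> P Pt; apply: (@cvg_within _ x^' _); exact: nbhs_dnbhs Pt.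
have := (cvgr0Pnorm_lt (F := nbhs x) (V := R[i]^o) (fun t => (t - x)%:C)).2.
(* The radius is an element of [R[i]]; being positive it has zero imaginary part, so the bound
   becomes a real one. *)
apply=> -[e e'] /[dup] + /gtr0_real.
rewrite complex_real /= => + /eqP e'0.
rewrite e'0 ltcR => e0.
near=> t; rewrite normc_def /= expr0n addr0 sqrtr_sqr ltcR distrC.
near: t; exact: (@cvgr_dist_lt _ R).
Unshelve. all: by end_near. Qed.

(** Each entry of [M t] is that of [M x] plus [t - x] times the difference quotient, which converges
    while [t - x] tends to 0. *)
Lemma has_deriv_cvg (m l : nat) (M : R -> 'M[R[i]]_(m, l))
    (D : 'M[R[i]]_(m, l)) :
  has_deriv J M x D ->
  (M : R -> 'M[R[i]^o]_(m, l)) @ within [set` J] x^'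
    --> (M x : 'M[R[i]^o]_(m, l)).
Proof.
move=> /cvg_mxP MD; apply/cvg_mxP => i j.
have MxE : {near within [set` J] x^', (fun t => M x i j + (t - x)%:C *
    ((t - x)^-1%:C *: (M t - M x)) i j : R[i]^o) =1 fun t => M t i j}.
  rewrite near_withinE; near=> t => _.
  rewrite !mxE mulrA -rmorphM divff ?mul1r ?subrKC//= subr_eq0.
  near: t; exact: nbhs_dnbhs_neq.
apply: cvg_trans (near_eq_cvg MxE) _.
rewrite -[X in _ `=>` nbhs X]addr0 -(mul0r (D i j)).
apply: (@cvgD _ R[i]^o); first exact: cvg_cst.
apply: (@cvgM R[i]) (MD i j).
exact: cvg_increment0.
Unshelve. all: by end_near. Qed.

Lemma has_deriv_rows_at (n k m : nat) (p : multi_index n k)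
    (M : R -> 'M[R[i]]_(n, m)) (D : 'M[R[i]]_(n, m)) :
  has_deriv J M x D -> has_deriv J (fun t => rows_at p (M t)) x (rows_at p D).
Proof.
move=> /cvg_mxP MD; apply/cvg_mxP => i j.
have := MD (mi_nth p i) j; rewrite !mxE.
by under eq_fun do rewrite !mxE; under [in X in _ -> X]eq_fun do rewrite !mxE.
Qed.

(** The limit is taken within [J], and [x \in J] ensures agreement of the base values that enter
    every quotient. *)
Lemma eq_has_deriv (m l : nat) (M N : R -> 'M[R[i]]_(m, l))
    (D : 'M[R[i]]_(m, l)) :
  x \in J -> {in J, M =1 N} -> has_deriv J M x D -> has_deriv J N x D.
Proof.
move=> xJ MN; apply: cvg_trans; apply: near_eq_cvg.
by rewrite near_withinE; near=> t => tJ; rewrite !MN.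
Unshelve. all: by end_near. Qed.

(* Differentiability of y is not assumed: its difference quotient is
   (dW - y(x) du) u(t)^-1 with dW, du those of W and u, so that only continuity
   of u^-1 is required. *)
Lemma has_deriv_left_factor (m l : nat) (W y : R -> 'M[R[i]]_(m, l))
    (u : R -> 'M[R[i]]_l) (W' : 'M[R[i]]_(m, l)) (u' : 'M[R[i]]_l) :
  x \in J -> (forall t, t \in J -> W t = y t *m u t /\ u t \in unitmx) ->
  has_deriv J W x W' -> has_deriv J u x u' ->
  has_deriv J y x ((W' - y x *m u') *m invmx (u x)).
Proof.
move=> xJ Wyu dW du.
have [Wx ux] := Wyu _ xJ.
have yE : {near within [set` J] x^', (fun t =>
    ((t - x)^-1%:C *: (W t - W x) + - y x *m ((t - x)^-1%:C *: (u t - u x)))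
      *m invmx (u t)) =1 fun t => (t - x)^-1%:C *: (y t - y x)}.
  rewrite near_withinE; near=> t => tJ; have [Wt ut] := Wyu _ tJ.
  rewrite -scalemxAr -scalerDr -scalemxAl; congr (_ *: _).
  (* The terms [y x *m u x] cancel, leaving [(y t - y x) *m u t] with [u t] invertible. *)
  rewrite mulNmx mulmxBr Wx Wt opprB addrA subrK -mulmxBl mulmxK //.
apply: cvg_trans (near_eq_cvg yE) _; rewrite -mulNmx.
apply: cvg_mulmx.
  by apply: cvg_addmx; [|apply: cvg_mulmx; first exact: cvg_cst].
apply: cvg_invmx ux _ (has_deriv_cvg du).
by rewrite near_withinE; near=> t => /Wyu[].
Unshelve. all: by end_near. Qed.

End ComplexDerivative.

(** * Column spans, row blocks and the chart *)

Lemma column_spanP (R : realType) (n k : nat) (Y : 'M[R[i]]_(n, k))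
    (v : 'cV_n) :
  reflect (exists c : 'cV_k, v = Y *m c) (v \in column_span Y).
Proof.
have colE c : Y *m c = \sum_j c j 0 *: col j Y.
  apply/matrixP => i l; rewrite ord1 mxE summxE.
  by apply: eq_bigr => j _; rewrite !mxE mulrC.
apply: (iffP idP) => [|[c ->]].
  rewrite /column_span span_def big_map big_enum => /memv_sumP[w wY ->].
  have /fin_all_exists[c cw] j : exists a, w j = a *: col j Y.
    exact/vlineP/wY.
  exists (\col_j c j); rewrite colE; apply: eq_bigr => j _.
  by rewrite mxE cw.
rewrite colE; apply: memv_suml => j _; apply/memvZ/memv_span.
by apply/mapP; exists j; rewrite ?mem_enum.
Qed.

(** Lets equality of planes be handled as matrix equations in the chart. *)
Lemma column_span_subP (R : realType) (n k l : nat)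
    (Y : 'M[R[i]]_(n, k)) (Z : 'M[R[i]]_(n, l)) :
  reflect (exists C, Y = Z *m C) (column_span Y <= column_span Z)%VS.
Proof.
apply: (iffP idP) => [sYZ|[C ->]].
  have /fin_all_exists[c cE] j : exists c, col j Y = Z *m c.
    apply/column_spanP/(subvP sYZ)/memv_span/mapP.
    by exists j; rewrite ?mem_enum.
  exists (\matrix_(i, j) c j i 0); apply/matrixP => i j.
  have /matrixP/(_ i 0) := cE j; rewrite !mxE => ->.
  by apply: eq_bigr => h _; rewrite mxE.
apply/subvP => v /column_spanP[c ->]; apply/column_spanP.
by exists (C *m c); rewrite mulmxA.
Qed.

Lemma dim_column_span (R : realType) (n k : nat) (Y : 'M[R[i]]_(n, k)) :
  stiefel Y -> \dim (column_span Y) = k.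
Proof.
move=> rkY; rewrite /column_span.
(* Full column rank yields a left inverse [B^T] of [Y], which kills any linear relation between the
   columns. *)
have /row_freeP[B YB] : row_free Y^T by rewrite /row_free mxrank_tr rkY.
have YK : B^T *m Y = 1%:M by rewrite -(trmxK Y) -trmx_mul YB trmx1.
set X := [seq _ | _ <- _].
have sX : size X == k by rewrite size_map size_enum_ord.
suff : free (Tuple sX) by rewrite /free /= => /eqP ->; exact/eqP.
apply/freeP => c c0 j.
have {}c0 : Y *m \col_j c j = 0.
  rewrite -[RHS]c0; apply/matrixP => i l; rewrite ord1 mxE summxE.
  apply: eq_bigr => h _; rewrite (nth_map h) ?size_enum_ord //.
  by rewrite nth_ord_enum !mxE mulrC.
have /matrixP/(_ j 0) : \col_j c j = 0.
  by rewrite -[LHS]mul1mx -YK -mulmxA c0 mulmx0.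
by rewrite !mxE.
Qed.

Lemma rows_atM (T : pzSemiRingType) (n k m l : nat) (p : multi_index n k)
    (M : 'M[T]_(n, m)) (N : 'M[T]_(m, l)) :
  rows_at p (M *m N) = rows_at p M *m N.
Proof. by rewrite /rows_at mul_rowsub_mx. Qed.

(** Block multiplication: the summation index is split between [p] and its complement, and each part
    is reindexed by its enumeration. *)
Lemma mul_submx_at (T : pzSemiRingType) (n k m l : nat) (p : multi_index n k)
    (r : multi_index n m) (M : 'M[T]_n) (N : 'M[T]_(n, l)) :
  rows_at r (M *m N) = submx_at r p M *m rows_at p N
    + submx_at r (mi_compl p) M *m rows_at (mi_compl p) N.
Proof.
have reindexp (m' : nat) (s : multi_index n m') (f : 'I_n -> T) :
    \sum_(j in mi_set s) f j = \sum_j f (mi_nth s j).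
  rewrite big_enum_val; apply: (reindex (cast_ord (esym (mi_card s)))).
  by exists (cast_ord (mi_card s)) => j _; rewrite ?cast_ordK ?cast_ordKV.
apply/matrixP => i j; rewrite !mxE (bigID (mem (mi_set p))) /= reindexp.
congr (_ + _); first by apply: eq_bigr => h _; rewrite !mxE.
under eq_bigl do rewrite -finset.in_setC.
by rewrite (reindexp _ (mi_compl p)); apply: eq_bigr => h _; rewrite !mxE.
Qed.

(** A competitor [z] with the same span is [y *m (u *m C)]; comparing [p]-rows forces [u *m C = 1],
    so [xget] can only select [y]. *)
Lemma chart_column_span (R : realType) (n k : nat) (p : multi_index n k)
    (y : 'M[R[i]]_(n, k)) (u : 'M[R[i]]_k) :
  rows_at p y = 1%:M -> u \in unitmx ->
  chart p (column_span (y *m u)) = rows_at (mi_compl p) y.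
Proof.
move=> y1 uu; congr rows_at; apply: xget_unique => [|z [/eqP]].
  split=> //; apply/eqP; rewrite eqEsubv.
  apply/andP; split; apply/column_span_subP; last by exists u.
  by exists (invmx u); rewrite mulmxK.
rewrite eqEsubv => /andP[/column_span_subP[C zE] _] z1.
have : u *m C = 1%:M by rewrite -z1 zE -mulmxA rows_atM y1 mul1mx.
by rewrite zE -mulmxA => ->; rewrite mulmx1.
Qed.

Theorem corollary1 (R : realType) (n k : nat) (k_ge1 : (1 <= k)%N)
    (k_le_n : (k <= n)%N) (A : R -> 'M[R[i]]_n) (p : multi_index n k)
    (J : interval R) (Y y : R -> 'M[R[i]]_(n, k)) (u : R -> 'M[R[i]]_k)
    (Y_stiefel : forall x, x \in J -> stiefel (Y x))
    (Y_solution : solves J (linear_field A) Y)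
    (Y_factor : forall x, x \in J ->
       [/\ Y x = y x *m u x, u x \in unitmx & rows_at p (y x) = 1%:M]) :
  let q := mi_compl p in
  let a x := submx_at p p (A x) in
  let b x := submx_at p q (A x) in
  let c x := submx_at q p (A x) in
  let d x := submx_at q q (A x) in
  let yhat x := rows_at q (y x) in
  let riccati x (z : 'M[R[i]]_(n - k, k)) : 'M[R[i]]_(n - k, k) :=
    c x + d x *m z - z *m a x - z *m b x *m z in
  decoupled J riccati (fun x z => a x + b x *m z) yhat u
  /\ ((forall x, x \in J ->
         coordinate_patch p (column_span (Y x))
         /\ chart p (column_span (Y x)) = yhat x)
      /\ solves J riccati yhat).
Proof.
move=> q a b c d yhat riccati.
(* Kept general in [s], to be taken as [p] for [u] and as [q] for [yhat *m u]. *)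
have rowsY r (s : multi_index n r) t : t \in J ->
    rows_at s (A t *m Y t)
    = (submx_at s p (A t) + submx_at s q (A t) *m yhat t) *m u t.
  move=> /Y_factor[YE _ y1].
  by rewrite (mul_submx_at p) YE !rows_atM y1 mul1mx mulmxA -mulmxDl.
have drows r (s : multi_index n r) x : x \in J ->
    has_deriv J (fun t => rows_at s (Y t)) x
      ((submx_at s p (A x) + submx_at s q (A x) *m yhat x) *m u x).
  move=> xJ; rewrite -rowsY //.
  apply: has_deriv_rows_at; exact: Y_solution.
have du x : x \in J -> has_deriv J u x ((a x + b x *m yhat x) *m u x).
  move=> xJ.
  have rowsYu : {in J, (fun t => rows_at p (Y t)) =1 u}.
    by move=> t /Y_factor[-> _ y1]; rewrite rows_atM y1 mul1mx.
  exact: eq_has_deriv xJ rowsYu (drows _ _ _ xJ).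
have dyhat x : x \in J -> has_deriv J yhat x (riccati x (yhat x)).
  move=> xJ; have [_ ux _] := Y_factor x xJ.
  have Wyu t : t \in J -> rows_at q (Y t) = yhat t *m u t /\ u t \in unitmx.
    by move=> /Y_factor[-> ut _]; rewrite rows_atM.
  (* The Riccati field is put in the form given by [has_deriv_left_factor]; a common right factor
     [u x] cancels. *)
  have -> : riccati x (yhat x)
      = ((c x + d x *m yhat x) *m u x
          - yhat x *m ((a x + b x *m yhat x) *m u x))
        *m invmx (u x).
    rewrite [yhat x *m (_ *m _)]mulmxA -mulmxBl mulmxK // mulmxDr opprD addrA.
    by rewrite [yhat x *m (_ *m _)]mulmxA.
  exact: has_deriv_left_factor xJ Wyu (drows _ _ _ xJ) (du x xJ).
(* What remains is geometric: the plane of [Y x] lies in the patch, with [Y x] itself as frame since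
   its [p]-rows are [u x], and its coordinate is [yhat x]. *)
split=> //; split=> // x xJ; have [YE ux y1] := Y_factor x xJ; split.
  split; first exact: dim_column_span (Y_stiefel x xJ).
  exists (Y x); split; [exact: Y_stiefel | by [] |].
  by rewrite YE rows_atM y1 mul1mx.
by rewrite YE chart_column_span.
Qed.
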